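(* Let $G$ be a hereditarily countably characteristically based self-replicating profinite group such that $\mathrm{Out}(G)=\mathrm{Aut}(G)/\mathrm{Inn}(G)$ is infinite. Then $G$ is not $\mathrm{Aut}_2$.
   Context: A profinite group is countably characteristically based if it has a countable base of neighborhoods of $1$ consisting of (topologically) characteristic open subgroups, and hereditarily countably characteristically based if every open subgroup is countably characteristically based. A profinite group $G$ is self-replicating if $G$ has trivial center and every open subgroup $K$ of $G$ contains an open subgroup $H$ such that (i) $H$ is normal in $G$ and $H\cong G\times G\times\cdots\times G$ ($n$ factors) for some $n>1$; (ii) the conjugation action of $G$ on $H$ permutes the factors of this decomposition transitively among themselves. For a profinite group $U$, $\mathrm{Aut}(U)$ is the group of continuous automorphisms, with the standard topology: a base of neighborhoods of $1$ is given by the sets $A(O)=\{\gamma\in\mathrm{Aut}(U):\gamma(g)\equiv g \bmod O \text{ for all } g\in U\}$, $O$ an open subgroup of $U$. $\mathrm{Inn}(U)$ is the subgroup of inner automorphisms, and $\mathrm{TAut}(U)$ is the subgroup of those automorphisms which fix pointwise some open subgroup of $U$. Commensurator of a profinite group $G$: a virtual automorphism of $G$ is a topological isomorphism between two open subgroups of $G$; two are equivalent if they coincide on some open subgroup; the equivalence classes form, under composition (after restricting to suitable open subgroups), a group $\mathrm{Comm}(G)$. For an open subgroup $U$ of $G$, the homomorphism $\rho_U:\mathrm{Aut}(U)\to\mathrm{Comm}(G)$ sends an automorphism to its class; its kernel is $\mathrm{TAut}(U)$, and its image $\underline{\mathrm{Aut}}(U)\cong\mathrm{Aut}(U)/\mathrm{TAut}(U)$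 carries the quotient topology. $G$ is $\mathrm{Aut}_1$ if $\mathrm{TAut}(U)$ is closed in $\mathrm{Aut}(U)$ for every open subgroup $U$ of $G$. For open subgroups $V\subseteq U$ of $G$, let $\mathrm{Aut}(U)_V=\{\alpha\in\mathrm{Aut}(U):\alpha(V)=V\}$, and let $\underline{\mathrm{Aut}}(U)_V=\rho_U(\mathrm{Aut}(U)_V)\subseteq\underline{\mathrm{Aut}}(V)$. An open subgroup $U$ of $G$ is $\mathrm{Aut}$-stable if $\underline{\mathrm{Aut}}(U)_V$ is open in $\underline{\mathrm{Aut}}(V)$ for every open subgroup $V$ of $U$. $G$ is $\mathrm{Aut}_2$ if $G$ is $\mathrm{Aut}_1$ and some open subgroup of $G$ is $\mathrm{Aut}$-stable. *)

(* Defs.v *)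
From HB Require Import structures.
From mathcomp Require Import all_boot.
From mathcomp Require Import generic_quotient.
From mathcomp Require Import all_classical topology.

Set Implicit Arguments.
Unset Strict Implicit.
Unset Printing Implicit Defensive.

Local Open Scope classical_set_scope.
Local Open Scope group_scope.

HB.mixin Record isTopologicalGroup G & Topological G & Group G := {
  mulg_continuous : continuous (fun x : G * G => x.1 * x.2);
  invg_continuous : continuous (fun x : G => x^-1)
}.

#[short(type="topologicalGroupType")]
HB.structure Definition TopologicalGroup :=
  {G of Topological G & Group G & isTopologicalGroup G}.

Definition profinite (G : topologicalGroupType) : Prop :=
  [/\ compact [set: G], hausdorff_space G & totally_disconnected [set: G]].

Definition centerless (G : groupType) : Prop :=
  forall z : G, (forall g : G, commute z g) -> z = 1.

Record openSubgroup (G : topologicalGroupType) := OpenSubgroup {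
  carrier :> set G;
  carrier_open : open carrier;
  carrier1 : carrier 1;
  carrierF : forall x y, carrier x -> carrier y -> carrier (x / y)
}.

Lemma continuous_map_pair (X Y : topologicalType) (f : X -> Y) :
  continuous f -> continuous (fun q : X * X => (f q.1, f q.2)).
Proof.
move=> fc q; apply: cvg_pair.
  by apply: continuous_comp; [exact: cvg_fst|exact: fc].
by apply: continuous_comp; [exact: cvg_snd|exact: fc].
Qed.

(* A set coerces to the type of its elements, so an open subgroup is itself a
   topological group, for the subspace topology. *)
Section OpenSubgroupGroup.
Variables (G : topologicalGroupType) (U : openSubgroup G).
Local Notation osg := (set_type (carrier U)).

Lemma carrierV x : carrier U x -> carrier U x^-1.
Proof. by move=> Ux; rewrite -div1g; apply: carrierF => //; exact: carrier1. Qed.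

Lemma carrierM x y : carrier U x -> carrier U y -> carrier U (x * y).
Proof.
by move=> Ux Uy; rewrite -(invgK y); apply: carrierF => //; exact: carrierV.
Qed.

Definition osg_mk x (Ux : carrier U x) : osg := exist _ x (mem_set Ux).
Lemma osg_valP (x : osg) : carrier U (val x).
Proof. exact: set_mem (valP x). Qed.

Definition osg_one := osg_mk (carrier1 U).
Definition osg_inv (x : osg) := osg_mk (carrierV (osg_valP x)).
Definition osg_mul (x y : osg) := osg_mk (carrierM (osg_valP x) (osg_valP y)).

Lemma osg_mulA : associative osg_mul.
Proof. by move=> x y z; apply: val_inj; exact: mulgA. Qed.
Lemma osg_mul1 : left_id osg_one osg_mul.
Proof. by move=> x; apply: val_inj; exact: mul1g. Qed.
Lemma osg_1mul : right_id osg_one osg_mul.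
Proof. by move=> x; apply: val_inj; exact: mulg1. Qed.
Lemma osg_invK : involutive osg_inv.
Proof. by move=> x; apply: val_inj; exact: invgK. Qed.
Lemma osg_invM : {morph osg_inv : x y / osg_mul x y >-> osg_mul y x}.
Proof. by move=> x y; apply: val_inj; exact: invgM. Qed.
Lemma osg_mulV : left_inverse osg_one osg_inv osg_mul.
Proof. by move=> x; apply: val_inj; exact: mulVg. Qed.

HB.instance Definition _ := hasMul.Build osg osg_mul.
HB.instance Definition _ := Magma_isSemigroup.Build osg osg_mulA.
HB.instance Definition _ := hasOne.Build osg osg_one.
HB.instance Definition _ := BaseUMagma_isUMagma.Build osg osg_mul1 osg_1mul.
HB.instance Definition _ := hasInv.Build osg osg_inv.
HB.instance Definition _ := Monoid_isStarMonoid.Build osg osg_invK osg_invM.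
HB.instance Definition _ := StarMonoid_isGroup.Build osg osg_mulV.

Lemma osg_val_continuous : continuous (val : osg -> G).
Proof. exact: initial_continuous. Qed.

Lemma osg_mul_continuous : continuous (fun x : osg * osg => x.1 * x.2).
Proof.
apply: (@continuous_comp_initial _ _ _ (set_val : osg -> G)) => p.
apply: (@continuous_comp _ _ _ (fun q : osg * osg => (val q.1, val q.2))
  (fun q : G * G => q.1 * q.2)); last exact: mulg_continuous.
exact/continuous_map_pair/osg_val_continuous.
Qed.

Lemma osg_inv_continuous : continuous (fun x : osg => x^-1).
Proof.
apply: (@continuous_comp_initial _ _ _ (set_val : osg -> G)) => p.
exact: (@continuous_comp osg G G val (fun y : G => y^-1) p
  (@osg_val_continuous p) (@invg_continuous G (val p))).
Qed.

HB.instance Definition _ :=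
  isTopologicalGroup.Build osg osg_mul_continuous osg_inv_continuous.

End OpenSubgroupGroup.

(* the direct power G x ... x G (n factors), with the product topology *)
Definition dpower (G : topologicalGroupType) (n : nat) : Type :=
  {ptws 'I_n -> G}.

Section DirectPower.
Variables (G : topologicalGroupType) (n : nat).
Local Notation Gn := (dpower G n).

HB.instance Definition _ := Topological.copy Gn {ptws 'I_n -> G}.

Definition dpower_mul (x y : Gn) : Gn := fun i => x i * y i.
Definition dpower_one : Gn := fun=> 1.
Definition dpower_inv (x : Gn) : Gn := fun i => (x i)^-1.

Lemma dpower_mulA : associative dpower_mul.
Proof. by move=> x y z; apply/funext => i; exact: mulgA. Qed.
Lemma dpower_mul1 : left_id dpower_one dpower_mul.
Proof. by move=> x; apply/funext => i; exact: mul1g. Qed.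
Lemma dpower_1mul : right_id dpower_one dpower_mul.
Proof. by move=> x; apply/funext => i; exact: mulg1. Qed.
Lemma dpower_invK : involutive dpower_inv.
Proof. by move=> x; apply/funext => i; exact: invgK. Qed.
Lemma dpower_invM :
  {morph dpower_inv : x y / dpower_mul x y >-> dpower_mul y x}.
Proof. by move=> x y; apply/funext => i; exact: invgM. Qed.
Lemma dpower_mulV : left_inverse dpower_one dpower_inv dpower_mul.
Proof. by move=> x; apply/funext => i; exact: mulVg. Qed.

HB.instance Definition _ := hasMul.Build Gn dpower_mul.
HB.instance Definition _ := Magma_isSemigroup.Build Gn dpower_mulA.
HB.instance Definition _ := hasOne.Build Gn dpower_one.
HB.instance Definition _ := BaseUMagma_isUMagma.Build Gn dpower_mul1 dpower_1mul.
HB.instance Definition _ := hasInv.Build Gn dpower_inv.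
HB.instance Definition _ := Monoid_isStarMonoid.Build Gn dpower_invK dpower_invM.
HB.instance Definition _ := StarMonoid_isGroup.Build Gn dpower_mulV.

Lemma dpower_proj_continuous i : continuous (fun x : Gn => x i).
Proof. exact: (@proj_continuous _ (fun _ : 'I_n => G) i). Qed.

Lemma continuous_dpower (X : topologicalType) (f : X -> Gn) :
  (forall i, continuous (fun x => f x i)) -> continuous f.
Proof.
move=> fc x; apply/cvg_sup => i.
exact: (@continuous_comp_initial _ _ _ (fun g : Gn => g i) f (fc i)).
Qed.

Lemma dpower_mul_continuous : continuous (fun x : Gn * Gn => x.1 * x.2).
Proof.
apply: continuous_dpower => i p.
apply: (@continuous_comp _ _ _ (fun q : Gn * Gn => (q.1 i, q.2 i))
  (fun q : G * G => q.1 * q.2)); last exact: mulg_continuous.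
exact: (@continuous_map_pair Gn G (fun x => x i) (@dpower_proj_continuous i)).
Qed.

Lemma dpower_inv_continuous : continuous (fun x : Gn => x^-1).
Proof.
apply: continuous_dpower => i p.
exact: (@continuous_comp Gn G G (fun x : Gn => x i) (fun y : G => y^-1) p
  (@dpower_proj_continuous i p) (@invg_continuous G (p i))).
Qed.

HB.instance Definition _ :=
  isTopologicalGroup.Build Gn dpower_mul_continuous dpower_inv_continuous.

End DirectPower.

Definition topological_isomorphism (S T : topologicalGroupType) (f : S -> T) :=
  {morph f : x y / x * y} /\
  exists g : T -> S, [/\ cancel f g, cancel g f, continuous f & continuous g].

(* topological automorphisms; for profinite T the continuity of the inverse
   follows from that of the automorphism *)
Record aut (T : topologicalGroupType) := Aut {
  aut_fun :> T -> T;
  autP : topological_isomorphism aut_fun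
}.

Section AutGroup.
Variable T : topologicalGroupType.
Implicit Types a b c : aut T.

Lemma aut_ext a b : (forall x, a x = b x) -> a = b.
Proof.
case: a b => [f fP] [g gP] /= /funext fg; rewrite fg in fP *.
by congr Aut; exact: Prop_irrelevance.
Qed.

Lemma aut1_subproof : topological_isomorphism (@id T).
Proof. by split=> //; exists id; split=> // x; exact: cvg_id. Qed.
Definition aut_one := Aut aut1_subproof.

Lemma autM_subproof a b : topological_isomorphism (a \o b).
Proof.
have [aM [a' [aK a'K ac a'c]]] := autP a; have [bM [b' [bK b'K bc b'c]]] := autP b.
split=> [x y /=|]; first by rewrite bM aM.
exists (b' \o a'); split; [exact: can_comp|exact: can_comp| |].
- by move=> x; apply: continuous_comp; [exact: bc|exact: ac].
- by move=> x; apply: continuous_comp; [exact: a'c|exact: b'c].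
Qed.
Definition aut_mul a b := Aut (autM_subproof a b).

Lemma autV_subproof a : exists f : T -> T,
  topological_isomorphism f /\ cancel a f.
Proof.
have [aM [a' [aK a'K ac a'c]]] := autP a; exists a'; split=> //; split.
  by move=> x y; apply: (can_inj aK); rewrite aM !a'K.
by exists a.
Qed.
Definition aut_inv a :=
  Aut (projT2 (cid (autV_subproof a))).1.

Lemma aut_invl a x : aut_inv a (a x) = x.
Proof. exact: (projT2 (cid (autV_subproof a))).2. Qed.

Lemma aut_invr a x : a (aut_inv a x) = x.
Proof.
have [_ [a' [aK a'K _ _]]] := autP a.
by apply: (can_inj a'K); rewrite -{1}(a'K x) aut_invl aK.
Qed.

HB.instance Definition _ := gen_eqMixin (aut T).
HB.instance Definition _ := gen_choiceMixin (aut T).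

Lemma aut_mulA : associative aut_mul. Proof. by move=> *; apply: aut_ext. Qed.
Lemma aut_mul1 : left_id aut_one aut_mul. Proof. by move=> *; apply: aut_ext. Qed.
Lemma aut_1mul : right_id aut_one aut_mul. Proof. by move=> *; apply: aut_ext. Qed.
Lemma aut_mulV : left_inverse aut_one aut_inv aut_mul.
Proof. by move=> a; apply: aut_ext => x; exact: aut_invl. Qed.
Lemma aut_invK : involutive aut_inv.
Proof.
by move=> a; apply: aut_ext => x; rewrite -[in LHS](aut_invl a x) aut_invl.
Qed.
Lemma aut_invM : {morph aut_inv : a b / aut_mul a b >-> aut_mul b a}.
Proof.
move=> a b; apply: aut_ext => x; rewrite -{1}(aut_invr a x).
by rewrite -{1}(aut_invr b (aut_inv a x)) (aut_invl (aut_mul a b)).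
Qed.

HB.instance Definition _ := hasMul.Build (aut T) aut_mul.
HB.instance Definition _ := Magma_isSemigroup.Build (aut T) aut_mulA.
HB.instance Definition _ := hasOne.Build (aut T) aut_one.
HB.instance Definition _ := BaseUMagma_isUMagma.Build (aut T) aut_mul1 aut_1mul.
HB.instance Definition _ := hasInv.Build (aut T) aut_inv.
HB.instance Definition _ := Monoid_isStarMonoid.Build (aut T) aut_invK aut_invM.
HB.instance Definition _ := StarMonoid_isGroup.Build (aut T) aut_mulV.

(* the set A(O): c(g) and g have the same coset modulo O for all g *)
Definition aut_congr (O : openSubgroup T) : set (aut T) :=
  [set c | forall g : T, carrier O (g^-1 * c g)].

(* the group topology on Aut(T) in which the sets A(O) are a base of
   neighborhoods of 1 (see nbhs_aut1E below) *)
Definition aut_open : set_system (aut T) := [set W | forall a, W a ->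
  exists O : openSubgroup T, forall c, aut_congr O c -> W (c * a)].

Definition openSubgroupT : openSubgroup T :=
  @OpenSubgroup T setT openT I (fun _ _ _ _ => I).

Lemma openSubgroupI_subproof (O P : openSubgroup T) x y :
  ((O : set T) `&` P) x -> ((O : set T) `&` P) y -> ((O : set T) `&` P) (x / y).
Proof. by case=> Ox Px [Oy Py]; split; exact: carrierF. Qed.
Definition openSubgroupI (O P : openSubgroup T) : openSubgroup T :=
  @OpenSubgroup T (O `&` P) (openI (carrier_open O) (carrier_open P))
    (conj (carrier1 O) (carrier1 P)) (@openSubgroupI_subproof O P).

Lemma aut_openT : aut_open setT.
Proof. by move=> a _; exists openSubgroupT. Qed.
Lemma aut_openI : setI_closed aut_open.
Proof.
move=> V W oV oW a [/oV[O VO] /oW[P WP]]; exists (openSubgroupI O P) => c cOP.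
by split; [apply: VO | apply: WP] => g; case: (cOP g).
Qed.
Lemma aut_open_bigU (I : Type) (f : I -> set (aut T)) :
  (forall i, aut_open (f i)) -> aut_open (\bigcup_i f i).
Proof.
by move=> fo a [i _ /fo[O fO]]; exists O => c /fO fc; exists i.
Qed.

HB.instance Definition _ :=
  isOpenTopological.Build (aut T) aut_openT aut_openI aut_open_bigU.

Lemma nbhs_aut1E (W : set (aut T)) :
  nbhs (1 : aut T) W <-> exists O : openSubgroup T, aut_congr O `<=` W.
Proof.
split=> [[B [oB B1 BW]]|[O OW]].
  by have [O BO] := oB _ B1; exists O => c /BO; rewrite mulg1 => /BW.
exists (aut_congr O); split=> //; last first.
  by move=> g; rewrite mulVg; exact: carrier1.
move=> a aO; exists O => c cO g.
by have := carrierM (aO g) (cO (a g)); rewrite mulgA mulgK.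
Qed.

End AutGroup.

Definition inn (T : topologicalGroupType) : set (aut T) :=
  [set a | exists h : T, forall x, a x = x ^ h].

Arguments inn T : clear implicits.

(* Out(T) = Aut(T)/Inn(T), as the set of cosets of Inn(T) *)
Definition out (T : topologicalGroupType) : set (set (aut T)) :=
  [set [set a * i | i in inn T] | a in [set: aut T]].

Definition taut (T : topologicalGroupType) : set (aut T) :=
  [set a | exists O : openSubgroup T, forall x, carrier O x -> a x = x].

Arguments out T : clear implicits.
Arguments taut T : clear implicits.

Definition characteristic (T : topologicalGroupType) (O : set T) : Prop :=
  forall a : aut T, a @` O = O.

Definition countably_char_based (T : topologicalGroupType) : Prop :=
  exists B : set (openSubgroup T), [/\ countable B,
    forall O, B O -> characteristic O &
    forall N : set T, nbhs 1 N -> exists2 O, B O & (O : set T) `<=` N].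

Definition hereditarily_countably_char_based (G : topologicalGroupType) : Prop :=
  forall U : openSubgroup G, countably_char_based U.

(* the i-th factor of H, given an isomorphism phi from G^n to H, seen in G *)
Definition factor (G : topologicalGroupType) (H : openSubgroup G) (n : nat)
    (phi : dpower G n -> H) (i : 'I_n) : set G :=
  [set val (phi x) | x in [set x : dpower G n | forall j, j != i -> x j = 1]].

Definition self_replicating (G : topologicalGroupType) : Prop :=
  centerless G /\
  forall K : openSubgroup G, exists H : openSubgroup G,
    [/\ (H : set G) `<=` K,
        forall h g : G, carrier H h -> carrier H (h ^ g) &
        exists n : nat, (1 < n)%N /\ exists phi : dpower G n -> H,
          [/\ topological_isomorphism phi,
              forall (g : G) (i : 'I_n), exists j : 'I_n,
                [set x ^ g | x in factor phi i] = factor phi j &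
              forall i j : 'I_n, exists g : G,
                [set x ^ g | x in factor phi i] = factor phi j]].

Section Commensurator.
Variable G : topologicalGroupType.

Record virtual_aut := VirtualAut {
  vdom : openSubgroup G;
  vcod : openSubgroup G;
  vfun :> vdom -> vcod;
  vfunP : topological_isomorphism vfun
}.

HB.instance Definition _ := gen_eqMixin virtual_aut.
HB.instance Definition _ := gen_choiceMixin virtual_aut.

Definition vequiv (f g : virtual_aut) : Prop :=
  exists W : openSubgroup G, [/\ (W : set G) `<=` vdom f,
    (W : set G) `<=` vdom g &
    forall (x : vdom f) (y : vdom g),
      val x = val y -> carrier W (val x) -> val (f x) = val (g y)].

Definition vequivb (f g : virtual_aut) : bool := `[< vequiv f g >].

Lemma vequiv_refl : reflexive vequivb.
Proof.
move=> f; apply/asboolP; exists (vdom f).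
by split=> // x y /val_inj->.
Qed.

Lemma vequiv_sym : symmetric vequivb.
Proof.
by move=> f g; apply/asboolP/asboolP => -[W [Wf Wg fg]]; exists W; split=> // x y
  xy Wx; rewrite (fg y x) // -?xy.
Qed.

Lemma vequiv_trans : transitive vequivb.
Proof.
move=> g f h /asboolP[W [Wf Wg fg]] /asboolP[W' [Wg' Wh gh]]; apply/asboolP.
exists (openSubgroupI W W'); split=> [x [/Wf]|x [_ /Wh]|x y xy [Wx Wx']] //.
by rewrite (fg x (osg_mk (Wg _ Wx))) // (gh _ y).
Qed.

Canonical vequiv_equiv : equiv_rel virtual_aut :=
  EquivRel vequivb vequiv_refl vequiv_sym vequiv_trans.

(* the underlying set of Comm(G); its group law is not needed *)
Definition comm : Type := {eq_quot vequivb}%qT.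

Definition rho (U : openSubgroup G) (a : aut U) : comm :=
  (\pi_({eq_quot vequivb}%qT) (VirtualAut (autP a)))%qT.
Arguments rho U a : clear implicits.

(* the image of rho_U in Comm(G), and its open subsets for the quotient
   topology of Aut(U) -> rho_U(Aut(U)) *)
Definition uaut (U : openSubgroup G) : set comm := range (rho U).

Definition uaut_open (U : openSubgroup G) (S : set comm) : Prop :=
  S `<=` uaut U /\ open (rho U @^-1` S).

(* alpha(V) = V, with V viewed as a subset of U *)
Definition aut_stab (U V : openSubgroup G) : set (aut U) :=
  [set a | a @` [set x : U | carrier V (val x)] = [set x : U | carrier V (val x)]].
Arguments aut_stab U V : clear implicits.

Definition uaut_stab (U V : openSubgroup G) : set comm :=
  rho U @` aut_stab U V.

Definition aut_stable (U : openSubgroup G) : Prop :=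
  forall V : openSubgroup G, (V : set G) `<=` U -> uaut_open V (uaut_stab U V).

Definition is_Aut1 : Prop := forall U : openSubgroup G, closed (taut U).

Definition is_Aut2 : Prop :=
  is_Aut1 /\ exists U : openSubgroup G, aut_stable U.

End Commensurator.

Arguments rho {G} U a.
Arguments aut_stab {G} U V.

(* Main.v *)
(* By self-replication every open subgroup U contains an open subgroup V having a
   copy of G as a direct factor, such that some g in U conjugates that factor
   into the complementary one. If U is Aut-stable, then every automorphism c of
   G close to 1, extended to V by the identity on the complement, extends
   further to an automorphism b of U: the two agree on all of V, and not only
   near 1, because the elements of G with open centralizer form a closed (Aut_1)
   and hence trivial subgroup. On the factor, conjugation by g b(g)^-1 then is
   c, because b fixes the g-conjugate of the factor. As V has finite index and
   acts on the factor by inner automorphisms, there are finitely many such c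
   modulo Inn(G); since those c contain a subgroup of finite index in Aut(G),
   Out(G) is finite. *)
Require Import Defs.
From HB Require Import structures.
From mathcomp Require Import finmap all_boot generic_quotient all_classical topology.

Set Implicit Arguments.
Unset Strict Implicit.
Unset Printing Implicit Defensive.

Local Open Scope classical_set_scope.
Local Open Scope group_scope.

(** * Homomorphisms, topological groups and their open subgroups *)

Section Morphisms.
Variables (S T : groupType) (f : S -> T).
Hypothesis fM : {morph f : x y / x * y}.

Lemma morph1 : f 1 = 1.
Proof. by apply: (mulgI (f 1)); rewrite -fM !mulg1. Qed.

Lemma morphV x : f x^-1 = (f x)^-1.
Proof. by apply: (mulgI (f x)); rewrite -fM !mulgV morph1. Qed.

Lemma morphJ x y : f (x ^ y) = f x ^ f y.
Proof. by rewrite !conjgE !fM morphV. Qed.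

End Morphisms.

Lemma continuous_compose (X Y Z : topologicalType) (f : X -> Y) (g : Y -> Z) :
  continuous f -> continuous g -> continuous (g \o f).
Proof. by move=> fc gc x; apply: continuous_comp; [exact: fc|exact: gc]. Qed.

Section TopologicalGroups.
Variable T : topologicalGroupType.
Implicit Types (x y z : T) (O : openSubgroup T) (a b : aut T).

Lemma continuousM (X : topologicalType) (f g : X -> T) :
  continuous f -> continuous g -> continuous (fun t => f t * g t).
Proof.
move=> fc gc t.
apply: (@continuous_comp _ _ _ (fun t => (f t, g t)) (fun p : T * T => p.1 * p.2));
  last exact: mulg_continuous.
by apply: cvg_pair; [exact: fc|exact: gc].
Qed.

Lemma continuousV (X : topologicalType) (f : X -> T) :
  continuous f -> continuous (fun t => (f t)^-1).
Proof. by move=> fc t; exact: (continuous_comp (fc t) (@invg_continuous T _)). Qed.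

Lemma continuousJ (X : topologicalType) (f g : X -> T) :
  continuous f -> continuous g -> continuous (fun t => f t ^ g t).
Proof.
move=> fc gc; apply: continuousM; first exact: continuousV.
exact: continuousM.
Qed.

Lemma continuous_id : continuous (@id T). Proof. by move=> x; exact: cvg_id. Qed.

Lemma continuous_constant (X : topologicalType) x : continuous (fun _ : X => x).
Proof. by move=> t; exact: cvg_cst. Qed.

Lemma openSubgroup_nbhs O : nbhs (1 : T) (O : set T).
Proof. by apply: open_nbhs_nbhs; split; [exact: carrier_open|exact: carrier1]. Qed.

Lemma open_coset O x : open [set y | (O : set T) (x^-1 * y)].
Proof.
apply: (@open_comp _ _ (fun y => x^-1 * y)); last exact: carrier_open.
by move=> y _; apply: continuousM; [exact: continuous_constant|exact: continuous_id].
Qed.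

Lemma nbhs_coset O x : nbhs x [set y | (O : set T) (x^-1 * y)].
Proof.
by apply: open_nbhs_nbhs; split; [exact: open_coset|rewrite /= mulVg; exact: carrier1].
Qed.

Lemma conj_autP z : topological_isomorphism (fun x => x ^ z).
Proof.
have Jc (y : T) : continuous (fun x => x ^ y).
  by apply: continuousJ; [exact: continuous_id|exact: continuous_constant].
split; first by move=> x y; exact: conjMg.
by exists (fun x => x ^ z^-1); split=> // x; rewrite ?conjgK ?conjgKV.
Qed.

Definition conj_aut z := Aut (conj_autP z).

Lemma conj_autV z : conj_aut z^-1 = (conj_aut z)^-1.
Proof.
apply: (mulgI (conj_aut z)); rewrite mulgV; apply: aut_ext => x.
exact: (conjgKV z x).
Qed.

Lemma aut_continuous a : continuous a.
Proof. by have [_ [b []]] := autP a. Qed.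

Lemma autM a : {morph a : x y / x * y}.
Proof. by case: (autP a). Qed.

Lemma characteristicP O x a : characteristic (O : set T) -> (O : set T) x -> (O : set T) (a x).
Proof. by move=> Och Ox; rewrite -(Och a); exists x. Qed.

Lemma char_base_sub (N : set T) : countably_char_based T -> nbhs 1 N ->
  exists2 O : openSubgroup T, characteristic (O : set T) & (O : set T) `<=` N.
Proof. by move=> [B [_ Bc Bb]] /Bb[O /Bc Oc ON]; exists O. Qed.

Lemma closed_set_coset O x : closed [set y | (O : set T) (x^-1 * y)].
Proof.
move=> y /(_ _ (nbhs_coset O y))[z [/= xz yz]].
by have := carrierM xz (carrierV yz); rewrite invgM invgK mulgA mulgK.
Qed.

(** The elements with open centralizer, which are those whose conjugation has trivial class in the
    commensurator. A centralizer is a subgroup, so containing a neighborhood of 1 makes it open. *)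
Definition vcenter : set T := [set z | \forall x \near (1 : T), commute z x].

Lemma vcenterM y z : vcenter y -> vcenter z -> vcenter (y * z).
Proof.
apply: filterS2 => x yx zx.
exact/commute_sym/commuteM/commute_sym/zx/commute_sym.
Qed.

End TopologicalGroups.
Arguments vcenter T : clear implicits.

Section OpenSubgroups.
Variables (G : topologicalGroupType) (V : openSubgroup G).

Lemma osg_continuous (X : topologicalType) (f : X -> V) :
  continuous (val \o f) -> continuous f.
Proof. exact: (@continuous_comp_initial _ _ _ (set_val : V -> G)). Qed.

Lemma open_osg (A : set V) : open A -> open (val @` A : set G).
Proof.
move=> [B oB BA]; suff -> : val @` A = B `&` (V : set G).
  by apply: openI => //; exact: carrier_open.
rewrite -BA; apply/seteqP; split=> [_ [x Bx <-]|x [Bx Vx]].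
  by split; [exact: Bx|exact: osg_valP].
by exists (osg_mk Vx).
Qed.

Lemma nbhs_osg (A : set V) : nbhs 1 A -> nbhs (1 : G) (val @` A).
Proof.
rewrite nbhsE => -[B [oB B1] BA]; apply: (filterS (P := val @` B)).
  exact: image_subset.
by apply: open_nbhs_nbhs; split; [exact: open_osg|exists 1].
Qed.

End OpenSubgroups.

(** * Closedness of the virtual center *)

Section WholeGroup.
Variable G : topologicalGroupType.
Local Notation GT := (openSubgroupT G).

Definition whole (x : G) : GT := @osg_mk G GT x I.

Lemma whole_continuous : continuous whole.
Proof. apply: osg_continuous; exact: continuous_id. Qed.

Lemma whole_autP (a : aut G) : topological_isomorphism (fun x : GT => whole (a (val x))).
Proof.
have vc := @osg_val_continuous G GT.
split; first by move=> x y; apply: val_inj; exact: autM.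
exists (fun x : GT => whole (aut_inv a (val x))); split.
- by move=> x; apply: val_inj; exact: aut_invl.
- by move=> x; apply: val_inj; exact: aut_invr.
- apply: osg_continuous; exact: (continuous_compose vc (@aut_continuous _ a)).
- apply: osg_continuous; exact: (continuous_compose vc (@aut_continuous _ (aut_inv a))).
Qed.

Lemma whole_osg_subproof (O : openSubgroup GT) : open [set x | (O : set GT) (whole x)].
Proof. by apply: open_comp (carrier_open O) => x _; exact: whole_continuous. Qed.

Lemma wholeM : {morph whole : x y / x * y}.
Proof. by move=> x y; apply: val_inj. Qed.

Lemma whole_osg1_subproof (O : openSubgroup GT) : (O : set GT) (whole 1).
Proof. by rewrite (morph1 wholeM); exact: carrier1. Qed.

Lemma whole_osgF_subproof (O : openSubgroup GT) (x y : G) :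
  (O : set GT) (whole x) -> (O : set GT) (whole y) -> (O : set GT) (whole (x / y)).
Proof. by rewrite wholeM (morphV wholeM); exact: carrierF. Qed.

Definition whole_osg (O : openSubgroup GT) : openSubgroup G :=
  @OpenSubgroup G _ (whole_osg_subproof O) (whole_osg1_subproof O) (@whole_osgF_subproof O).

(** The hypothesis yields a base for the subtype [openSubgroupT G], not for [G] itself. The base is
    transported along [whole], through which automorphisms of [G] lift. *)
Lemma hereditarily_ccb_ccb : hereditarily_countably_char_based G -> countably_char_based G.
Proof.
move=> /(_ GT)[B [cB Bch Bb]]; exists (whole_osg @` B); split.
- exact: sub_countable (card_image_le _ _) cB.
- move=> _ [O BO <-] a; apply/seteqP; split=> [_ [x Ox <-]|x Ox].
    exact: (characteristicP (Aut (whole_autP a)) (Bch _ BO) Ox).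
  exists (aut_inv a x); last exact: aut_invr.
  exact: (characteristicP (Aut (whole_autP (aut_inv a))) (Bch _ BO) Ox).
- move=> N N1; have [|O BO ON] := Bb (fun x => N (val x)).
    exact: (@osg_val_continuous G GT (1 : GT)).
  by exists (whole_osg O); [exists O|move=> x /ON].
Qed.

(** An element lies in [vcenter G] exactly when conjugation by it lies in [taut]. Conjugation
    depends continuously on the element because [G] has a base of characteristic subgroups, so a
    limit of elements of [vcenter G] gives a limit of elements of the closed set [taut]. *)
Lemma vcenter_closed : hereditarily_countably_char_based G -> closed (taut GT) ->
  closed (vcenter G).
Proof.
move=> hb tc x clx; have cG := hb GT; have cG' := hereditarily_ccb_ccb hb.
have key y : taut GT (conj_aut (whole y)) -> vcenter G y.
  move=> [O fixO]; apply: filterS (openSubgroup_nbhs (whole_osg O)) => z Oz.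
  have zy : z ^ y = z := congr1 val (fixO _ Oz).
  by rewrite /commute [z * y]conjgC zy.
apply: key; apply: tc => W; rewrite nbhsE => -[W' [oW' W'x] W'W].
have [O OW'] := oW' _ W'x.
have [O' O'ch O'O] := char_base_sub cG' (openSubgroup_nbhs (whole_osg O)).
have [y [/= Vy xy]] := clx _ (nbhs_coset O' x).
exists (conj_aut (whole y)); split.
  have [K _ KV] := char_base_sub cG (@osg_val_continuous G GT (1 : GT) _ Vy).
  exists K => z /KV /= yz; apply: val_inj.
  by rewrite /= /conjg -[val z * y]yz mulKg.
apply: W'W; rewrite -[conj_aut _](mulgVK (conj_aut (whole x))).
apply: OW' => g; rewrite -conj_autV.
(* With t = [x^-1 * y] in [O'], the displacement of [g] is (t^-1)^g * t, a product of two elements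
   of [O'], since [O'] is stable under conjugation. *)
have -> : g^-1 * (conj_aut (whole y) * conj_aut (whole x)^-1) g =
    whole (((x^-1 * y)^-1) ^ (val g) * (x^-1 * y)).
  apply: val_inj; change ((val g)^-1 * (val g ^ x^-1) ^ y =
    ((x^-1 * y)^-1) ^ val g * (x^-1 * y)).
  by rewrite -conjgM !conjgE !mulgA.
apply: O'O; apply: carrierM => //; apply: (characteristicP (conj_aut (val g)) O'ch).
exact: carrierV.
Qed.

End WholeGroup.

(** * Direct factors isomorphic to the whole group *)

Section DirectFactors.
Variable G : topologicalGroupType.
Implicit Types H V K : openSubgroup G.

(* V is the direct product of the image of emb and the kernel of prj *)
Record direct_factor (V : openSubgroup G) := DirectFactor {
  emb : G -> V;
  prj : V -> G;
  embM : {morph emb : x y / x * y};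
  prjM : {morph prj : x y / x * y};
  emb_continuous : continuous emb;
  prj_continuous : continuous prj;
  embK : cancel emb prj;
  embJ : forall x v, emb x ^ v = emb (x ^ prj v)
}.

Section Coordinate.
Variables (V : openSubgroup G) (n : nat) (i : 'I_n) (phi : dpower G n -> V).
Variable (phi' : V -> dpower G n).
Hypotheses (phiM : {morph phi : x y / x * y}) (phiK : cancel phi phi').
Hypotheses (phi'K : cancel phi' phi) (phi_continuous : continuous phi).
Hypothesis (phi'_continuous : continuous phi').

Definition single (x : G) : dpower G n := fun j => if j == i then x else 1.

Lemma singleE x : single x i = x.
Proof. by rewrite /single eqxx. Qed.

Lemma singleM : {morph single : x y / x * y}.
Proof.
move=> x y; apply/funext => j.
change (single (x * y) j = single x j * single y j).
by rewrite /single; case: eqP; rewrite // mulg1.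
Qed.

Lemma singleJ x y : single x ^ y = single (x ^ y i).
Proof.
apply/funext => j; change (single x j ^ y j = single (x ^ y i) j).
by rewrite /single; case: eqP => [->//|_]; rewrite conj1g.
Qed.

Lemma single_continuous : continuous single.
Proof.
apply: continuous_dpower => j; rewrite /single; case: eqP => _.
  exact: continuous_id.
exact: continuous_constant.
Qed.

Lemma phi'M : {morph phi' : x y / x * y}.
Proof. by move=> x y; apply: (can_inj phiK); rewrite phiM !phi'K. Qed.

Definition coordinate_factor : direct_factor V.
Proof.
apply: (@DirectFactor V (fun x => phi (single x)) (fun v => phi' v i)).
- by move=> x y; rewrite singleM phiM.
- by move=> v w; rewrite phi'M.
- exact: continuous_compose single_continuous phi_continuous.
- exact: continuous_compose phi'_continuous (@dpower_proj_continuous G n i).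
- by move=> x; rewrite phiK singleE.
- by move=> x v; rewrite -{1}(phi'K v) -(morphJ phiM) singleJ.
Defined.

End Coordinate.

(** As n > 1, transitivity gives [g] carrying the factor of index 0 to that of index 1, whose
    elements have trivial coordinate 0. Nothing places [g] in [K]. *)
Lemma self_replicating_factor K : self_replicating G ->
  exists H, (H : set G) `<=` K /\ exists (D : direct_factor H) (g : G),
    forall x, exists2 y : H, val y = val (emb D x) ^ g & prj D y = 1.
Proof.
move=> [_ /(_ K)[H [HK _ [n [n1 [phi [[phiM [phi' [phiK phi'K phic phi'c]]] _ trans]]]]]]].
exists H; split=> //.
have n0 : (0 < n)%N by exact: ltnW.
pose i := Ordinal n0; pose j := Ordinal n1.
exists (coordinate_factor i phiM phiK phi'K phic phi'c).
have [g gij] := trans i j; exists g => x.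
have : Defs.factor phi j (val (phi (single i x)) ^ g).
  rewrite -gij; exists (val (phi (single i x))) => //; exists (single i x) => //.
  by move=> k /negbTE ki; rewrite /single ki.
move=> [z /(_ i) zi <-]; exists (phi z) => //=.
by rewrite phiK zi.
Qed.

Section Compose.
Variables (H H0 : openSubgroup G) (D : direct_factor H) (D0 : direct_factor H0).

(** Write [H] as the product of a copy of [G] and the kernel of [prj D]. Shrinking the copy of [G]
    to [H0] leaves [W], whose direct factor [H0] again has a copy of [G] as a direct factor. *)
Let W : set G := val @` (prj D @^-1` (H0 : set G)).

Lemma pull_open : open W.
Proof.
apply: open_osg; apply: open_comp (carrier_open H0) => x _; exact: prj_continuous.
Qed.

Lemma pull1 : W 1.
Proof. by exists 1 => //; rewrite /= (morph1 (@prjM _ D)); exact: carrier1. Qed.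

Lemma pullF x y : W x -> W y -> W (x / y).
Proof.
move=> [v Hv <-] [w Hw <-]; exists (v / w) => //=.
by rewrite prjM (morphV (@prjM _ D)); exact: carrierF.
Qed.

Definition pull : openSubgroup G := OpenSubgroup pull_open pull1 pullF.

Lemma pull_sub : (pull : set G) `<=` H.
Proof. by move=> _ [v _ <-]; exact: osg_valP. Qed.

Definition pull_incl (v : pull) : H := osg_mk (pull_sub (osg_valP v)).

Lemma pull_prjP (v : pull) : (H0 : set G) (prj D (pull_incl v)).
Proof.
have [w Hw wv] := osg_valP v.
by have -> : pull_incl v = w by apply: val_inj.
Qed.

Definition pull_prj (v : pull) : H0 := osg_mk (pull_prjP v).

Lemma pull_embP x : (pull : set G) (val (emb D (val (emb D0 x)))).
Proof. by exists (emb D (val (emb D0 x))) => //=; rewrite embK; exact: osg_valP. Qed.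

Definition pull_emb x : pull := osg_mk (pull_embP x).

Lemma pull_incl_emb x : pull_incl (pull_emb x) = emb D (val (emb D0 x)).
Proof. exact: val_inj. Qed.

Lemma pull_inclM : {morph pull_incl : x y / x * y}.
Proof. by move=> x y; apply: val_inj. Qed.

Lemma pull_prjM : {morph pull_prj : x y / x * y}.
Proof. by move=> x y; apply: val_inj; rewrite /= pull_inclM prjM. Qed.

Lemma pull_incl_inj : injective pull_incl.
Proof. by move=> x y /(congr1 val) xy; apply: val_inj. Qed.

Lemma pull_incl_continuous : continuous pull_incl.
Proof. by apply: osg_continuous; exact: osg_val_continuous. Qed.

Definition compose_factor : direct_factor pull.
Proof.
apply: (@DirectFactor pull pull_emb (fun v => prj D0 (pull_prj v))).
- by move=> x y; apply: pull_incl_inj; rewrite pull_inclM !pull_incl_emb embM /= embM.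
- by move=> x y; rewrite pull_prjM prjM.
- apply: osg_continuous; apply: continuous_compose (@osg_val_continuous G H).
  apply: continuous_compose (@emb_continuous _ D).
  exact: continuous_compose (@emb_continuous _ D0) (@osg_val_continuous G H0).
- apply: (@continuous_compose _ _ _ pull_prj) (@prj_continuous _ D0).
  apply: osg_continuous.
  exact: continuous_compose pull_incl_continuous (@prj_continuous _ D).
- move=> x; rewrite -[RHS](embK D0); congr prj.
  by apply: val_inj; rewrite /= pull_incl_emb embK.
- move=> x v; apply: pull_incl_inj.
  rewrite (morphJ pull_inclM) !pull_incl_emb embJ -(embJ D0).
  by congr emb.
Defined.

End Compose.

(** To get the conjugator into [U], self-replication is applied twice: first to find a copy of [G]
    in [U], then inside that copy. The second conjugator [g] becomes [emb D g], an element of [H]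
    and so of [U]. *)
Lemma self_replicating_movable_factor (U : openSubgroup G) : self_replicating G ->
  exists V : openSubgroup G, (V : set G) `<=` U /\
  exists (D : direct_factor V), exists2 g : G, (U : set G) g &
    forall x, exists2 y : V, val y = val (emb D x) ^ g & prj D y = 1.
Proof.
move=> sr; have [H [HU [D _]]] := self_replicating_factor U sr.
have [H0 [_ [D0 [g gP]]]] := self_replicating_factor (openSubgroupT G) sr.
exists (pull H0 D); split; first by move=> x /pull_sub /HU.
exists (compose_factor D D0), (val (emb D g)); first by apply: HU; exact: osg_valP.
move=> x; have [y yE y1] := gP x.
have Wy : (pull H0 D : set G) (val (emb D (val y))).
  by exists (emb D (val y)) => //=; rewrite embK; exact: osg_valP.
exists (osg_mk Wy).
  by rewrite /= yE (morphJ (@embM _ D)).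
rewrite /=; have -> : pull_prj (osg_mk Wy) = y => //.
apply: val_inj => /=; have -> : pull_incl (osg_mk Wy) = emb D (val y) by exact: val_inj.
exact: embK.
Qed.

End DirectFactors.

(** * Triviality of the virtual center *)

Section VirtualCenter.
Variable G : topologicalGroupType.

Lemma countable_base_seq : countably_char_based G ->
  exists K : nat -> openSubgroup G,
    forall N : set G, nbhs 1 N -> exists k, (K k : set G) `<=` N.
Proof.
move=> [B [/countable_injP[f finj] _ Bb]].
have /boolp.choice[K KP] k : exists O, forall O', B O' -> f O' = k -> O = O'.
  have [[O [BO fO]]|nO] := pselect (exists O, B O /\ f O = k).
    by exists O => O' BO' fO'; apply: finj; rewrite ?inE ?fO.
  (* Indices outside the range of [f] get the whole group as a harmless default. *)
  by exists (openSubgroupT G) => O' BO' fO'; case: nO; exists O'.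
exists K => N /Bb[O BO ON]; exists (f O).
by rewrite (KP _ O).
Qed.

(** An element [v] of [V] conjugates [emb D z] through [prj D v], which is close to 1, hence
    commutes with [z], once [v] is close to 1. *)
Lemma vcenter_emb (V : openSubgroup G) (D : direct_factor V) z :
  vcenter G z -> vcenter G (val (emb D z)).
Proof.
move=> Vz; have : nbhs (1 : V) [set v | commute z (prj D v)].
  by apply: prj_continuous; rewrite (morph1 (@prjM _ _ D)).
move=> /nbhs_osg; apply: filterS => _ [v zv <-].
suff : commute (emb D z) v by move=> /(congr1 val).
by rewrite /commute [LHS]conjgC embJ conjgE zv mulKg.
Qed.

Lemma open_noncommute h : hausdorff_space G -> open [set y : G | ~ commute y h].
Proof.
move=> hG; have -> : [set y | ~ commute y h] = (fun y => y^-1 * y ^ h) @^-1` (~` [set 1]).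
  apply/seteqP; split=> y /= yh E; apply: yh.
    by apply/commgP/eqP.
  by move: E => /commgP/eqP.
apply: open_comp.
  move=> y _; apply: continuousM; first by apply: continuousV; exact: continuous_id.
  by apply: continuousJ; [exact: continuous_id|exact: continuous_constant].
apply: closed_openC; apply: accessible_closed_set1; exact: hausdorff_accessible.
Qed.

Lemma cluster_closed (u : nat -> G) (A : set G) x k0 : closed A ->
  (forall k, (k0 <= k)%N -> A (u k)) -> cluster (u @ \oo) x -> A x.
Proof.
move=> cA Au clx; apply: cA => W Wx.
apply: clx => //; exists k0 => //=.
Qed.

(* Otherwise, by a Baire category argument, a limit of elements of the virtual
   center would centralize no term of a countable base, although the virtual
   center is closed. *)
Lemma vcenter_trivial z : compact [set: G] -> hausdorff_space G ->
  countably_char_based G -> self_replicating G -> closed (vcenter G) ->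
  vcenter G z -> z = 1.
Proof.
move=> cG hG ccb sr clV Vz; apply: contrapT => z1.
have [K Kb] := countable_base_seq ccb.
(* A state is a point and an open subgroup, standing for a coset to which all later points are
   confined. Stage k shrinks it to a coset none of whose elements commutes with a certain [h] in
   [K k]. The guard [vcenter G s.1] lets the successor be chosen for every state. *)
pose good k (s t : G * openSubgroup G) := vcenter G s.1 ->
  [/\ vcenter G t.1, (s.2 : set G) (s.1^-1 * t.1), (t.2 : set G) `<=` s.2 &
   exists2 h, (K k : set G) h & forall y, (t.2 : set G) (t.1^-1 * y) -> ~ commute y h].
have step (ks : nat * (G * openSubgroup G)) : exists t, good ks.1 ks.2 t.
  case: ks => k [x N]; rewrite /good /=.
  have [Vx|nVx] := pselect (vcenter G x); last by exists (x, N).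
  (* The copy of [G] lies in both [K k] and [N], so the image [w] of [z] is a step allowed by [N],
     and the copy can be tested against [K k]. *)
  have [H [HK [D _]]] := self_replicating_factor (openSubgroupI (K k) N) sr.
  pose w := val (emb D z).
  have [h [Kh [x' [Vx' xx' x'h]]]] : exists h, (K k : set G) h /\
      exists x', [/\ vcenter G x', (N : set G) (x^-1 * x') & ~ commute x' h].
    (* Otherwise [x] and [x * w] both centralize [K k], so [w] centralizes the copy of [G], and [z]
       is central. *)
    apply: contrapT => nh; apply: z1; apply: sr.1 => g.
    have cK x' h : vcenter G x' -> (N : set G) (x^-1 * x') -> (K k : set G) h -> commute x' h.
      by move=> Vx' xx' Kh; apply: contrapT => nc; apply: nh; exists h; split=> //; exists x'.
    have [KH NH] := HK _ (osg_valP (emb D g)).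
    have xh : commute x (val (emb D g)).
      by apply: cK => //; rewrite mulVg; exact: carrier1.
    have Vw : vcenter G w by exact: vcenter_emb.
    have xwh : commute (x * w) (val (emb D g)).
      apply: cK => //; first exact: vcenterM.
      by rewrite mulKg; case: (HK _ (osg_valP (emb D z))).
    have wg : emb D z * emb D g = emb D g * emb D z.
      apply: val_inj; apply: (mulgI x); rewrite -/w.
      change (x * (w * val (emb D g)) = x * (val (emb D g) * w)).
      by rewrite mulgA xwh mulgA -xh mulgA.
    by apply: (can_inj (embK D)); rewrite !embM.
  (* Not commuting with [h] is an open condition, so it holds on a whole coset of [x']. *)
  have [O _ Oh] : exists2 O : openSubgroup G, characteristic (O : set G) &
      (O : set G) `<=` [set u | ~ commute (x' * u) h].
    apply: char_base_sub => //.
    have c : continuous (fun u : G => x' * u).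
      by apply: continuousM; [exact: continuous_constant|exact: continuous_id].
    apply: (c 1 [set y | ~ commute y h]); apply: open_nbhs_nbhs; split.
      exact: open_noncommute.
    by rewrite /= mulg1.
  exists (x', openSubgroupI O N); split=> //=.
  by exists h => // y [/Oh /=]; rewrite mulVKg.
have [F FP] := boolp.choice step.
pose s := fix s k := if k is k'.+1 then F (k', s k') else (1, openSubgroupT G).
have Vs k : vcenter G (s k).1.
  elim: k => [|k IH] /=; last by case: (FP (k, s k) IH).
  by apply: nearW => x; exact/commute_sym/commute1.
have sP k := FP (k, s k) (Vs k).
have nested k j : (k <= j)%N ->
    ((s k).2 : set G) ((s k).1^-1 * (s j).1) /\ ((s j).2 : set G) `<=` (s k).2.
  elim: j => [|j IH]; first by rewrite leqn0 => /eqP->; rewrite mulVg; split=> //;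
    exact: carrier1.
  rewrite leq_eqVlt => /orP[/eqP->|]; first by rewrite mulVg; split=> //; exact: carrier1.
  rewrite ltnS => /IH[sk ss]; have [_ /= sj sss _] := sP j; split; last first.
    by move=> u /sss /ss.
  by have := carrierM sk (ss _ sj); rewrite mulgA mulgK.
(* A cluster point [x] lies in the closed set [vcenter G] and in every closed coset of the sequence.
   It therefore centralizes some [K k], against the [h] of stage k. *)
have [x [_ clx]] := cG ((fun k => (s k).1) @ \oo) _ filterT.
have Vx : vcenter G x by apply: (cluster_closed (k0 := 0%N) clV _ clx) => k _; exact: Vs.
have [k KV] := Kb _ Vx.
have [_ _ _ [h Kh nh]] := sP k.
apply: (nh x); last by exact: KV.
apply: (cluster_closed (k0 := k.+1) (@closed_set_coset _ _ (s k.+1).1) _ clx) => j kj.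
exact: (nested _ _ kj).1.
Qed.

End VirtualCenter.

(** * Automorphisms acting on one direct factor only *)

Section Twist.
Variables (G : topologicalGroupType) (V : openSubgroup G) (D : direct_factor V).
Implicit Types (c : aut G) (v w : V).

(** This is [c] on the factor times the identity on the complement: if v = k * emb p with k in the
    kernel of [prj D], the value is k * emb (c p). *)
Definition twist_fun c v : V := v * emb D ((prj D v)^-1 * c (prj D v)).

Lemma twist_prj c v : prj D (twist_fun c v) = c (prj D v).
Proof. by rewrite /twist_fun prjM embK mulVKg. Qed.

Lemma twist_comp a b v : twist_fun a (twist_fun b v) = twist_fun (a * b) v.
Proof.
rewrite {1}/twist_fun twist_prj /twist_fun -mulgA -embM; congr (_ * emb D _).
by rewrite -mulgA mulVKg.
Qed.

Lemma twist1 v : twist_fun 1 v = v.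
Proof. by rewrite /twist_fun mulVg (morph1 (@embM _ _ D)) mulg1. Qed.

Lemma twistM c : {morph twist_fun c : v w / v * w}.
Proof.
move=> v w; rewrite /twist_fun -[RHS]mulgA [X in _ = _ * X]mulgA [X in _ = _ * (X * _)]conjgC.
rewrite embJ -[X in _ = _ * X]mulgA -embM mulgA; congr (_ * emb D _).
by rewrite !prjM autM conjgE invgM !mulgA mulgK.
Qed.

Lemma twist_continuous c : continuous (twist_fun c).
Proof.
apply: continuousM; first exact: continuous_id.
apply: (@continuous_compose _ _ _ (fun v => (prj D v)^-1 * c (prj D v)))
  (@emb_continuous _ _ D).
apply: continuousM; first by apply: continuousV; exact: prj_continuous.
exact: continuous_compose (@prj_continuous _ _ D) (@aut_continuous _ c).
Qed.

Lemma twistP c : topological_isomorphism (twist_fun c).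
Proof.
split; first exact: twistM.
exists (twist_fun c^-1); split; try exact: twist_continuous.
  by move=> v; rewrite twist_comp mulVg twist1.
by move=> v; rewrite twist_comp mulgV twist1.
Qed.

Definition twist c : aut V := Aut (twistP c).

Lemma twist_emb c x : twist c (emb D x) = emb D (c x).
Proof. by rewrite /= /twist_fun embK -embM mulVKg. Qed.

Lemma twist_ker c v : prj D v = 1 -> twist c v = v.
Proof.
rewrite /= /twist_fun => ->.
by rewrite (morph1 (@autM _ c)) mulVg (morph1 (@embM _ _ D)) mulg1.
Qed.

End Twist.

(** * Extending automorphisms to an Aut-stable subgroup *)

Section Extension.
Variables (G : topologicalGroupType).
Hypothesis vcenter1 : forall z, vcenter G z -> z = 1.

(** For [y] near 1, put t = a^-1(y). Near 1 the maps [a] and [b] agree, so both send t to [y] and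
    they have the same value at t^(v^-1). Hence [b u] and [a v] conjugate [y] alike, and their
    quotient lies in the trivial [vcenter G]. *)
Lemma vequiv_aut_eq (U V : openSubgroup G) (b : aut U) (a : aut V) :
  vequiv (VirtualAut (autP b)) (VirtualAut (autP a)) ->
  forall (u : U) (v : V), val u = val v -> val (b u) = val (a v).
Proof.
move=> [W [WU WV ba0]] u v uv.
have ba (x : U) (y : V) : val x = val y -> (W : set G) (val x) -> val (b x) = val (a y).
  exact: ba0.
suff zV : vcenter G ((val (a v))^-1 * val (b u)).
  by have /(congr1 (mul (val (a v)))) := vcenter1 zV; rewrite mulVKg mulg1.
pose a' := aut_inv a.
have W1 f : continuous f -> f 1 = 1 -> nbhs (1 : V) [set y : V | (W : set G) (val (f y : V))].
  move=> fc f1; have c := continuous_compose fc (@osg_val_continuous G V).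
  by apply: (c 1); rewrite /= f1; exact: openSubgroup_nbhs.
have a'1 : a' 1 = 1 := morph1 (@autM _ a').
(* Both the preimage of [y] and its conjugate must land in [W], where the two maps are known to
   agree. *)
have Wa : nbhs (1 : V) [set y : V | (W : set G) (val (a' y ^ v^-1))].
  apply: W1; last by rewrite a'1 conj1g.
  by apply: continuousJ; [exact: aut_continuous|exact: continuous_constant].
have Waa : nbhs (1 : V)
    ([set y | (W : set G) (val (a' y))] `&` [set y | (W : set G) (val (a' y ^ v^-1))]).
  by apply: filterI => //; apply: W1 a'1; exact: aut_continuous.
move: (@nbhs_osg _ _ _ Waa); apply: filterS.
move=> _ [y [/= Wy Wyv] <-].
have wU : (U : set G) (val (a' y)) by exact: WU.
have by1 : val (b (osg_mk wU)) = val y.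
  have := ba (osg_mk wU) (a' y) erefl Wy.
  by rewrite aut_invr.
have wE : val (osg_mk wU ^ u^-1) = val (a' y ^ v^-1).
  by change (val (a' y) ^ (val u)^-1 = val (a' y) ^ (val v)^-1); rewrite uv.
have := ba _ _ wE; rewrite wE => /(_ Wyv).
rewrite (morphJ (@autM _ b)) (morphJ (@autM _ a)) (morphV (@autM _ b)) (morphV (@autM _ a)).
rewrite aut_invr => E.
have {}E : val y ^ (val (b u))^-1 = val y ^ (val (a v))^-1 by rewrite -{1}by1.
change ((val (a v))^-1 * val (b u) * val y = val y * ((val (a v))^-1 * val (b u))).
by rewrite [RHS]conjgC conjgM -E conjgKV.
Qed.

(** The subgroup [O] is taken characteristic so that the automorphisms congruent to 1 modulo [O]
    have finite index in Aut(G). *)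
Lemma aut_stable_conj (U V : openSubgroup G) (D : direct_factor V) (g : G) :
  countably_char_based G -> aut_stable U -> (V : set G) `<=` U -> (U : set G) g ->
  (forall x, exists2 y : V, val y = val (emb D x) ^ g & prj D y = 1) ->
  exists2 O : openSubgroup G, characteristic (O : set G) &
    forall c : aut G, aut_congr O c ->
      exists u, forall x, val (emb D (c x)) = val (emb D x) ^ u.
Proof.
move=> ccb stU VU Ug gP; have [_ op] := stU V VU.
(* The identity of [U] restricts to that of [V], so the open set contains 1 and thus some
   [aut_congr OV]. *)
have [|OV OVP] := op 1.
  exists 1; first by rewrite /aut_stab /=; exact: image_id.
  apply/eqP; rewrite eqmodE; apply/asboolP; exists V; split=> // x y xy _.
have [O Och OOV] : exists2 O : openSubgroup G, characteristic (O : set G) &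
    (O : set G) `<=` [set x | (OV : set V) (emb D x)].
  apply: char_base_sub => //; apply: emb_continuous.
  by rewrite (morph1 (@embM _ _ D)); exact: openSubgroup_nbhs.
exists O => // c cO.
have [|b _] := OVP (twist D c).
  by move=> v; rewrite /= /twist_fun mulKg; apply: OOV; exact: cO.
rewrite mulg1 => /eqP; rewrite eqmodE => /asboolP/vequiv_aut_eq bE.
pose gU : U := osg_mk Ug.
exists (val (gU * (b gU)^-1)) => x; have [y yE y1] := gP x.
pose v := emb D x; pose vU : U := osg_mk (VU _ (osg_valP v)).
have bv : val (b vU) = val (emb D (c x)) by rewrite (bE vU v) // twist_emb.
(* The conjugate [y] projects to 1, so the twist fixes it, and so does [b]. *)
have : val (b (vU ^ gU)) = val y by rewrite (bE _ y) ?twist_ker.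
rewrite (morphJ (@autM _ b)).
change (val (b vU) ^ val (b gU) = val y -> val (emb D (c x)) = val v ^ (g * (val (b gU))^-1)).
by rewrite bv yE -/v conjgM => <-; rewrite conjgK.
Qed.

End Extension.

(** * Finiteness of the outer automorphism group *)

Section FiniteOut.
Variable G : topologicalGroupType.
Hypothesis cG : compact [set: G].

(** The label [k] need not be constant on cosets. What counts is that elements with equal labels lie
    in the same coset. *)
Lemma finite_cosets (O : openSubgroup G) : exists (F : finType) (k : G -> F) (r : F -> G),
  forall x, (O : set G) ((r (k x))^-1 * x).
Proof.
have : cover_compact [set: G].
  (* [compact_cover] is stated for pointed spaces; the base point is 1. *)
  pose X : ptopologicalType := HB.pack (TopologicalGroup.sort G)
    (Topological.class G) (isPointed.Build (TopologicalGroup.sort G) (1 : G)).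
  by rewrite -(@compact_cover X).
move=> /(_ _ setT (fun x => [set y | (O : set G) (x^-1 * y)])).
case=> [x _|x _|S _ SP]; first exact: open_coset.
  by exists x => //=; rewrite mulVg; exact: carrier1.
have /boolp.choice[k kP] x : exists s : S, (O : set G) ((val s)^-1 * x).
  by have [s /= sS sx] := SP x I; exists [` sS]%fset.
by exists S, k, val.
Qed.

(** Pigeonhole: each label selects one element of [P] carrying it, if there is any. An element may
    carry several labels. *)
Lemma finite_representatives (A : Type) (F : finType) (P : set A) (R : A -> F -> Prop) :
  (forall a, P a -> exists y, R a y) ->
  exists2 S : set A, finite_set S &
    forall a, P a -> exists b, [/\ S b, P b & exists2 y, R a y & R b y].
Proof.
move=> PR; have [[a0 _]|nP] := pselect (exists a, P a); last first.
  by exists set0 => // a Pa; case: nP; exists a.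
have /boolp.choice[g gP] y : exists b, forall a, P a -> R a y -> P b /\ R b y.
  have [[b bP]|nb] := pselect (exists b, P b /\ R b y); first by exists b.
  by exists a0 => a Pa Ray; case: nb; exists a.
exists (range g); first exact: finite_image.
move=> a Pa; have [y Ray] := PR _ Pa; have [Pg Rg] := gP y a Pa Ray.
by exists (g y); split=> //; exists y.
Qed.

(** An automorphism permutes the finitely many cosets of [O]. Its label records the images of the
    representatives, and this determines it modulo [O]. *)
Lemma char_finite_index (O : openSubgroup G) : characteristic (O : set G) ->
  exists2 S : set (aut G), finite_set S &
    forall a, exists2 b, S b & aut_congr O (b^-1 * a).
Proof.
move=> Och; have [F [k [r rP]]] := finite_cosets O.
have [|S fS SP] := @finite_representatives (aut G) {ffun F -> F} setT
    (fun a f => f = [ffun i => k (a (r i))]).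
  by move=> a _; exists [ffun i => k (a (r i))].
exists S => // a; have [b [Sb _ [f -> /ffunP ab]]] := SP a I; exists b => // g.
set s := r (k g); have sg : (O : set G) (s^-1 * g) := rP g.
have : (O : set G) ((b s)^-1 * a s).
  have := ab (k g); rewrite !ffunE -/s => kab.
  have := carrierM (carrierV (rP (b s))) (rP (a s)).
  by rewrite -kab invgM invgK mulgA mulgK.
move=> /(characteristicP b^-1 Och); rewrite autM (morphV (@autM _ _)).
change (b^-1 (b s)) with (aut_inv b (b s)); rewrite aut_invl => sbas.
(* The congruence passes from [s] to [g], as [b^-1 * a] also preserves [O], which contains
   [s^-1 * g]. *)
have := carrierM (carrierM (carrierV sg) sbas) (characteristicP (b^-1 * a) Och sg).
rewrite autM (morphV (@autM _ _)); change ((b^-1 * a) s) with (b^-1 (a s)).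
by rewrite invgM invgK !mulgA !mulgK.
Qed.

(** If conjugations by [u] and [w] induce [c] and [d] on the factor and [u * w^-1] lies in [V], then
    d^-1 c is conjugation by the projection of [u * w^-1]. The labels use [u^-1] because [k] refers
    to left cosets. *)
Lemma conj_finite_index (V : openSubgroup G) (D : direct_factor V) (P : set (aut G)) :
  (forall c, P c -> exists u, forall x, val (emb D (c x)) = val (emb D x) ^ u) ->
  exists2 S : set (aut G), finite_set S &
    forall c, P c -> exists2 d, S d & inn G (d^-1 * c).
Proof.
move=> PV; have [F [k [r rP]]] := finite_cosets V.
have [|S fS SP] := @finite_representatives (aut G) F P
    (fun c y => exists2 u, y = k u^-1 & forall x, val (emb D (c x)) = val (emb D x) ^ u).
  by move=> c /PV[u cu]; exists (k u^-1), u.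
exists S => // c /SP[d [Sd _ [y [u -> cu] [w kuw dw]]]]; exists d => //.
have Vuw : (V : set G) (u * w^-1).
  have := carrierM (carrierV (rP u^-1)) (rP w^-1).
  by rewrite -kuw invgM !invgK mulgA mulgK.
exists (prj D (osg_mk Vuw)) => x; apply: (can_inj (embK D)); apply: val_inj.
rewrite -embJ; change (val (emb D ((d^-1 * c) x)) = val (emb D x) ^ (u * w^-1)).
rewrite conjgM -cu; apply: (canRL (conjgK _)); rewrite -dw.
by congr (val (emb D _)); exact: aut_invr.
Qed.

Lemma innE a : inn G a -> exists h, a = conj_aut h.
Proof. by move=> [h ah]; exists h; exact: aut_ext. Qed.

Lemma conj_autM (h l : G) : conj_aut h * conj_aut l = conj_aut (l * h).
Proof. by apply: aut_ext => x; exact/esym/conjgM. Qed.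

(** Each [a] is a product b * d * i with [b] in [S], [d] in [T] and i inner, so pairs in [S] and [T]
    exhaust the cosets of Inn(G). *)
Lemma finite_out (S T : set (aut G)) (P : set (aut G)) : finite_set S -> finite_set T ->
  (forall a, exists2 b, S b & P (b^-1 * a)) ->
  (forall c, P c -> exists2 d, T d & inn G (d^-1 * c)) -> finite_set (out G).
Proof.
move=> fS fT SP TP.
apply: (@sub_finite_set _ _
  ((fun p => [set p.1 * p.2 * i | i in inn G]) @` (S `*` T))); last first.
  by apply: finite_image; exact: finite_setX.
move=> _ [a _ <-]; have [b Sb /TP[d Td /innE[h dba]]] := SP a.
exists (b, d) => //=.
have -> : a = b * d * conj_aut h by rewrite -dba -!mulgA !mulVKg.
apply/seteqP; split=> _ [_ /innE[l ->] <-].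
  exists (conj_aut (l * h^-1)); first by exists (l * h^-1).
  by rewrite -mulgA conj_autM mulgVK.
exists (conj_aut (l * h)); first by exists (l * h).
by rewrite -[RHS]mulgA conj_autM.
Qed.

End FiniteOut.

Theorem proposition8p12 (G : topologicalGroupType) (hG : profinite G)
    (hbase : hereditarily_countably_char_based G)
    (hself : self_replicating G)
    (hout : infinite_set (out G)) :
  ~ is_Aut2 G.
Proof.
move=> [aut1 [U stU]]; apply: hout; have [cG hsG _] := hG.
have ccb := hereditarily_ccb_ccb hbase.
have vc1 z : vcenter G z -> z = 1.
  exact: vcenter_trivial cG hsG ccb hself (vcenter_closed hbase (aut1 _)).
have [V [VU [D [g Ug gP]]]] := self_replicating_movable_factor U hself.
have [O Och OP] := aut_stable_conj vc1 ccb stU VU Ug gP.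
have [S fS SP] := char_finite_index cG Och.
have [T fT TP] := conj_finite_index cG OP.
exact: finite_out fS fT SP TP.
Qed.
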